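(* Consider the scheme described in the context and suppose $h_j^0>0$ for all $j$. (i) (Time-explicit scheme, $\sharp=n$.) Assume that the time step $\Delta t$ is such that the CFL condition associated with the acoustic step $$\Delta t\max_{1\le j\le N}\Big(\tau_j^n\max_{k\in\mathcal{N}(j)}\sigma_{jk}a_{jk}\Big)\le\frac12$$ and the CFL condition associated with the transport step $$\Delta t\max_{1\le j\le N}\Big(\sum_{k\in\mathcal{N}(j),\,u_{jk}^n<0}\sigma_{jk}|u_{jk}^n|\Big)\le1$$ hold. Then the water height $h_j^n$ is positive for all $j$ and all $n>0$. Indeed, $L_j^n=1+\Delta t\sum_{k\in\mathcal{N}(j)}\sigma_{jk}u_{jk}^n$ is positive, and the transport step is a convex combination of states at the intermediate level $n+1-$. (ii) (Mixed implicit-explicit scheme, $\sharp=n+1-$.) The same properties hold under the sole transport CFL condition $$\Delta t\max_{1\le j\le N}\Big(\sum_{k\in\mathcal{N}(j),\,u_{jk}^{n+1-}<0}\sigma_{jk}|u_{jk}^{n+1-}|\Big)\le1;$$ in particular $h_j^n>0$ for all $j$ and all $n>0$. No CFL condition is required for the acoustic step, which is implicit.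
   Context: The scheme approximates the shallow water equations $\partial_t h+\nabla\cdot(h\mathbf{u})=0$, $\partial_t(h\mathbf{u})+\nabla\cdot(h\mathbf{u}\otimes\mathbf{u})+\nabla\frac{gh^2}{2}=-gh\nabla z$ in two space dimensions, with $g>0$ the gravity constant, $z$ a given smooth topography, water height $h$ and velocity $\mathbf{u}\in\mathbb{R}^2$. Mesh. The computational domain $\Omega\subset\mathbb{R}^2$ is covered by $N$ polygonal cells $(\Omega_j)_{1\le j\le N}$. Each face of $\Omega_j$ is either $\Gamma_{jk}=\overline{\Omega_j}\cap\overline{\Omega_k}$ for a single $k\in\{1,\dots,N\}$, or is contained in $\partial\Omega$ and is denoted $\Gamma_{jk}$ with a single index $k>N$, which indexes the ghost values used for the boundary conditions. $\mathcal{N}(j)$ is the set of $k$ such that $\Gamma_{jk}$ is a face of $\Omega_j$; for $k\in\mathcal{N}(j)$, $\mathbf{n}_{jk}$ is the unit normal to $\Gamma_{jk}$ pointing out of $\Omega_j$, and $\sigma_{jk}=|\Gamma_{jk}|/|\Omega_j|$ (length of the face over area of the cell). Unknowns. At time level $n$ the discrete state is $(h_j^n,\mathbf{u}_j^n)$, and $z_j$ is the discrete topography. Set $\tau_j^n=1/h_j^n$, $\Pi_j^n=g(h_j^n)^2/2$, $c_j^n=\sqrt{g h_j^n}$. Let $\Delta t>0$ be the time step and $a_{jk}\ge\max(h_j^nc_j^n,h_k^nc_k^n)$. The coefficient $\theta_{jk}$ is a correction parameter; in practice $\theta_{jk}=\min(|u_{jk}^n|/\max(c_j^n,c_k^n),1)$,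 where $u_{jk}^n$ is the velocity flux below evaluated with $\sharp=n$, and $\theta_{jk}=1$ gives the uncorrected scheme. In practice $a_{jk}=a_{kj}$ and $\theta_{jk}=\theta_{kj}$. Fluxes. Put $\{gh\Delta z\}_{jk}^n=g\frac{h_j^n+h_k^n}{2}(z_k-z_j)$ (always evaluated at level $n$) and, for $\sharp\in\{n,n+1-\}$, $$u_{jk}^{\sharp}=\tfrac12\mathbf{n}_{jk}^T(\mathbf{u}_j^\sharp+\mathbf{u}_k^\sharp)-\tfrac{1}{2a_{jk}}(\Pi_k^\sharp-\Pi_j^\sharp)-\tfrac{1}{2a_{jk}}\{gh\Delta z\}_{jk}^n,$$ $$\Pi_{jk}^{\sharp,\theta}=\tfrac12(\Pi_j^\sharp+\Pi_k^\sharp)-\tfrac{a_{jk}\theta_{jk}}{2}\mathbf{n}_{jk}^T(\mathbf{u}_k^\sharp-\mathbf{u}_j^\sharp)+\tfrac12\{gh\Delta z\}_{jk}^n.$$ Acoustic step (explicit if $\sharp=n$, implicit if $\sharp=n+1-$). The values at the intermediate level $n+1-$ are given by $$\tau_j^{n+1-}=\tau_j^n+\tau_j^n\Delta t\sum_{k\in\mathcal{N}(j)}\sigma_{jk}u_{jk}^\sharp,\quad \mathbf{u}_j^{n+1-}=\mathbf{u}_j^n-\tau_j^n\Delta t\sum_{k\in\mathcal{N}(j)}\sigma_{jk}\Pi_{jk}^{\sharp,\theta}\mathbf{n}_{jk},\quad \Pi_j^{n+1-}=\Pi_j^n-\tau_j^n\Delta t\sum_{k\in\mathcal{N}(j)}\sigma_{jk}(a_{jk})^2u_{jk}^\sharp,$$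 and $h_j^{n+1-}=1/\tau_j^{n+1-}$, $(h\mathbf{u})_j^{n+1-}=h_j^{n+1-}\mathbf{u}_j^{n+1-}$. Transport step (explicit). For $\varphi\in\{h,h\mathbf{u}\}$, $$\varphi_j^{n+1}=\varphi_j^{n+1-}-\Delta t\sum_{k\in\mathcal{N}(j)}\sigma_{jk}\varphi_{jk}^{n+1-}u_{jk}^\sharp+\Delta t\,\varphi_j^{n+1-}\sum_{k\in\mathcal{N}(j)}\sigma_{jk}u_{jk}^\sharp,$$ where $\varphi_{jk}^{n+1-}=\varphi_j^{n+1-}$ if $u_{jk}^\sharp\ge0$ and $\varphi_{jk}^{n+1-}=\varphi_k^{n+1-}$ if $u_{jk}^\sharp<0$.
   Formalization: The formal theorem also assumes that τ_j^{n+1-} is nonzero (with equality in the transport CFL, L_j can vanish and h_j^{n+1-} is undefined), and that ghost water heights at level n+1- are positive whenever all cell heights at that level are. *)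

(* Defs.v *)
From HB Require Import structures.
From mathcomp Require Import all_boot all_order all_algebra.
From mathcomp Require Import all_classical all_reals all_analysis.
Set Implicit Arguments.
Unset Strict Implicit.
Unset Printing Implicit Defensive.
Import numFieldNormedType.Exports.
Import Order.TTheory GRing.Theory Num.Theory.
Local Open Scope classical_set_scope.
Local Open Scope ring_scope.

(* Points and vectors of the plane are pairs of reals.  The library norm on
   R * R is the max norm, so the Euclidean structure is defined here. *)
Definition dot (R : realType) (u v : R * R) : R := u.1 * v.1 + u.2 * v.2.

Definition dist2 (R : realType) (p q : R * R) : R :=
  Num.sqrt (dot (q - p) (q - p)).

Definition area (R : realType) (A : set (R * R)) : R :=
  fine ((@lebesgue_measure R \x @lebesgue_measure R)%E A).

Definition segment (R : realType) (p q : R * R) : set (R * R) :=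
  [set (1 - t) *: p + t *: q | t in [set t : R | 0 <= t <= 1]].

Definition open_segment (R : realType) (p q : R * R) : set (R * R) :=
  [set (1 - t) *: p + t *: q | t in [set t : R | 0 < t < 1]].

(* Indices of discrete values: [inl j] is the cell j, [inr b] is a ghost value
   (an index k > N of a mesh with N cells). *)
Notation idx N G := ('I_N + 'I_G)%type.

(* A polygonal mesh with N cells.  [ends j k] are the two end points of the face
   Gamma_jk and [normal j k] is n_jk; both are meaningful only for [k \in nb j],
   where [nb j] is N(j). *)
Record mesh (R : realType) (N G : nat) := Mesh {
  domain : set (R * R);
  cell : 'I_N -> set (R * R);
  nb : 'I_N -> {set idx N G};
  ends : 'I_N -> idx N G -> (R * R) * (R * R);
  normal : 'I_N -> idx N G -> R * R;
  domain_open : open domain;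
  cell_open : forall j, open (cell j);
  cell_nonempty : forall j, cell j !=set0;
  cell_connected : forall j, connected (cell j);
  cell_bounded : forall j, bounded_set (cell j);
  cell_sub : forall j, cell j `<=` domain;
  cell_disjoint : forall i j, i != j -> cell i `&` cell j = set0;
  cell_cover : closure domain = \bigcup_(j in [set: 'I_N]) closure (cell j);
  (* cells are polygons: the boundary of a cell is the union of its faces, which
     are nondegenerate segments meeting only at end points *)
  face_ends : forall j k, k \in nb j -> (ends j k).1 != (ends j k).2;
  face_boundary : forall j,
    closure (cell j) `\` cell j =
    \bigcup_(k in [set k | k \in nb j]) segment (ends j k).1 (ends j k).2;
  face_meet : forall j k l, k \in nb j -> l \in nb j -> k != l ->
    segment (ends j k).1 (ends j k).2 `&` segment (ends j l).1 (ends j l).2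
      `<=` [set (ends j k).1; (ends j k).2];
  face_inner : forall j k, inl k \in nb j ->
    segment (ends j (inl k)).1 (ends j (inl k)).2
      = closure (cell j) `&` closure (cell k);
  face_ghost : forall j b, inr b \in nb j ->
    segment (ends j (inr b)).1 (ends j (inr b)).2
      `<=` closure domain `\` domain;
  normal_unit : forall j k, k \in nb j -> dot (normal j k) (normal j k) = 1;
  normal_orth : forall j k, k \in nb j ->
    dot (normal j k) ((ends j k).2 - (ends j k).1) = 0;
  normal_outward : forall j k, k \in nb j ->
    forall x, open_segment (ends j k).1 (ends j k).2 x ->
    \forall e \near 0^'+,
      cell j (x - e *: normal j k) /\ ~ closure (cell j) (x + e *: normal j k)
}.

Definition sigma (R : realType) N G (M : mesh R N G) (j : 'I_N) (k : idx N G)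
    : R :=
  dist2 (ends M j k).1 (ends M j k).2 / area (cell M j).

(* State at an integer time level n. *)
Record state (R : realType) (N G : nat) := State {
  height : idx N G -> R;
  vel : idx N G -> R * R
}.

(* State at the intermediate level n+1-.  The pressure [mPi] is an independent
   unknown there: it is not g h^2 / 2. *)
Record mstate (R : realType) (N G : nat) := MState {
  mtau : 'I_N -> R;
  mheight : idx N G -> R;
  mvel : idx N G -> R * R;
  mPi : idx N G -> R
}.

Definition tau (R : realType) N G (U : state R N G) (k : idx N G) : R :=
  (height U k)^-1.

Definition press (R : realType) N G (g : R) (U : state R N G) (k : idx N G)
    : R :=
  g * height U k ^+ 2 / 2.

Definition celerity (R : realType) N G (g : R) (U : state R N G)
    (k : idx N G) : R :=
  Num.sqrt (g * height U k).

(* The choice of the level # in the fluxes. *)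
Inductive sharp := Explicit | Implicit.

Definition vel_at (R : realType) N G (s : sharp) (U : state R N G)
    (V : mstate R N G) : idx N G -> R * R :=
  if s is Explicit then vel U else mvel V.

Definition press_at (R : realType) N G (g : R) (s : sharp) (U : state R N G)
    (V : mstate R N G) : idx N G -> R :=
  if s is Explicit then press g U else mPi V.

Definition ghdz (R : realType) N G (g : R) (z : idx N G -> R)
    (U : state R N G) (j : 'I_N) (k : idx N G) : R :=
  g * ((height U (inl j) + height U k) / 2) * (z k - z (inl j)).

Definition uflux (R : realType) N G (M : mesh R N G) (g : R)
    (z : idx N G -> R) (a : 'I_N -> idx N G -> R) (s : sharp)
    (U : state R N G) (V : mstate R N G) (j : 'I_N) (k : idx N G) : R :=
  let us := vel_at s U V in
  let Pis := press_at g s U V in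
  2^-1 * dot (normal M j k) (us (inl j) + us k)
  - (2 * a j k)^-1 * (Pis k - Pis (inl j))
  - (2 * a j k)^-1 * ghdz g z U j k.

Definition Piflux (R : realType) N G (M : mesh R N G) (g : R)
    (z : idx N G -> R) (a theta : 'I_N -> idx N G -> R) (s : sharp)
    (U : state R N G) (V : mstate R N G) (j : 'I_N) (k : idx N G) : R :=
  let us := vel_at s U V in
  let Pis := press_at g s U V in
  2^-1 * (Pis (inl j) + Pis k)
  - a j k * theta j k / 2 * dot (normal M j k) (us k - us (inl j))
  + 2^-1 * ghdz g z U j k.

(* The acoustic step is a relation between the levels n and n+1-; for
   [s = Implicit] the fluxes depend on V itself.  Division being total in the
   library, [mtau V j != 0] makes explicit that h^{n+1-} = 1 / tau^{n+1-} is a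
   genuine quotient. *)
Definition acoustic_step (R : realType) N G (M : mesh R N G) (g : R)
    (z : idx N G -> R) (dt : R) (a theta : 'I_N -> idx N G -> R) (s : sharp)
    (U : state R N G) (V : mstate R N G) : Prop :=
  forall j : 'I_N,
  [/\ mtau V j = tau U (inl j) + tau U (inl j) * dt *
        \sum_(k in nb M j) sigma M j k * uflux M g z a s U V j k,
      mvel V (inl j) = vel U (inl j) - (tau U (inl j) * dt) *:
        \sum_(k in nb M j)
          (sigma M j k * Piflux M g z a theta s U V j k) *: normal M j k,
      mPi V (inl j) = press g U (inl j) - tau U (inl j) * dt *
        \sum_(k in nb M j)
          sigma M j k * a j k ^+ 2 * uflux M g z a s U V j k,
      mtau V j != 0
    & mheight V (inl j) = (mtau V j)^-1].

(* The conserved variables (h, hu) transported in the second step. *)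
Definition conserved (R : realType) N G (U : state R N G) (k : idx N G)
    : R * (R * R) :=
  (height U k, height U k *: vel U k).

Definition mconserved (R : realType) N G (V : mstate R N G) (k : idx N G)
    : R * (R * R) :=
  (mheight V k, mheight V k *: mvel V k).

(* The transport step, written at once for phi = h and phi = hu; [U'] is the
   state at level n+1. *)
Definition transport_step (R : realType) N G (M : mesh R N G) (g : R)
    (z : idx N G -> R) (dt : R) (a : 'I_N -> idx N G -> R) (s : sharp)
    (U : state R N G) (V : mstate R N G) (U' : state R N G) : Prop :=
  forall j : 'I_N,
  let u := uflux M g z a s U V j in
  let upwind k := if 0 <= u k then mconserved V (inl j) else mconserved V k in
  conserved U' (inl j) =
    mconserved V (inl j)
    - dt *: (\sum_(k in nb M j) (sigma M j k * u k) *: upwind k)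
    + (dt * \sum_(k in nb M j) sigma M j k * u k) *: mconserved V (inl j).

Definition scheme_step (R : realType) N G (M : mesh R N G) (g : R)
    (z : idx N G -> R) (dt : R) (a theta : 'I_N -> idx N G -> R) (s : sharp)
    (U : state R N G) (V : mstate R N G) (U' : state R N G) : Prop :=
  acoustic_step M g z dt a theta s U V /\ transport_step M g z dt a s U V U'.

(* In both CFL conditions the maxima are those of families of nonnegative
   numbers, hence the neutral element 0. *)
Definition acoustic_cfl (R : realType) N G (M : mesh R N G) (dt : R)
    (a : 'I_N -> idx N G -> R) (U : state R N G) : Prop :=
  dt * \big[Num.max/0]_(j < N)
         (tau U (inl j) * \big[Num.max/0]_(k in nb M j) (sigma M j k * a j k))
  <= 2^-1.

Definition transport_cfl (R : realType) N G (M : mesh R N G) (g : R)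
    (z : idx N G -> R) (dt : R) (a : 'I_N -> idx N G -> R) (s : sharp)
    (U : state R N G) (V : mstate R N G) : Prop :=
  dt * \big[Num.max/0]_(j < N)
         \sum_(k in nb M j | uflux M g z a s U V j k < 0)
            sigma M j k * `|uflux M g z a s U V j k|
  <= 1.

Definition Lcoef (R : realType) N G (M : mesh R N G) (g : R)
    (z : idx N G -> R) (dt : R) (a : 'I_N -> idx N G -> R) (s : sharp)
    (U : state R N G) (V : mstate R N G) (j : 'I_N) : R :=
  1 + dt * \sum_(k in nb M j) sigma M j k * uflux M g z a s U V j k.

Definition convex_combination (R : realType) (I : finType) (W : lmodType R)
    (S : {set I}) (x : I -> W) (y : W) : Prop :=
  exists w : I -> R,
  [/\ forall i, i \in S -> 0 <= w i,
      \sum_(i in S) w i = 1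
    & y = \sum_(i in S) w i *: x i].

(* The boundary conditions produce positive ghost heights at the intermediate
   level from positive cell heights: this covers prescribed positive values as
   well as values copied from a cell (wall, outflow, periodic conditions). *)
Definition positive_ghosts (R : realType) N G (V : mstate R N G) : Prop :=
  (forall j, 0 < mheight V (inl j)) -> forall b, 0 < mheight V (inr b).

Definition height_properties (R : realType) N G (M : mesh R N G) (g : R)
    (z : idx N G -> R) (dt : nat -> R) (a : nat -> 'I_N -> idx N G -> R)
    (s : sharp) (U : nat -> state R N G) (V : nat -> mstate R N G) : Prop :=
  [/\ forall n j, (0 < n)%N -> 0 < height (U n) (inl j),
      forall n j, 0 < Lcoef M g z (dt n) (a n) s (U n) (V n) j
    & forall n j,
        convex_combination (inl j |: nb M j)%SET (mconserved (V n))
          (conserved (U n.+1) (inl j))].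

(* Main.v *)
Require Import Defs.
From HB Require Import structures.
From mathcomp Require Import all_boot all_order all_algebra.
From mathcomp Require Import all_classical all_reals all_analysis.
Set Implicit Arguments.
Unset Strict Implicit.
Unset Printing Implicit Defensive.
Import numFieldNormedType.Exports.
Import Order.TTheory GRing.Theory Num.Theory.
Local Open Scope ring_scope.

(** The mechanism is the same for the explicit and the implicit scheme.  The
    acoustic step gives tau_j^{n+1-} = tau_j^n L_j.  Only the incoming faces
    (u_jk < 0) contribute negatively to L_j - 1, each sigma_jk being
    nonnegative, and the transport CFL condition bounds their contribution
    from below by -1, so that L_j >= 0 ([Lcoef_ge0_of_transport_cfl]).
    As h_j^{n+1-} = 1 / tau_j^{n+1-} is a genuine quotient, L_j cannot vanish;
    hence L_j > 0, and the intermediate heights are positive when those of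
    level n are ([acoustic_step_positive]).

    In the transport step the outgoing fluxes (u_jk >= 0) carry the state of
    the cell j itself and cancel against the last term.  What remains is
      phi_j + sum over the incoming faces of dt sigma_jk |u_jk| (phi_k - phi_j),
    a convex combination as soon as the incoming coefficients have sum at
    most 1, which is the transport CFL condition
    ([transport_step_convex_combination]).  A convex combination of
    positive heights is positive, and induction on n concludes. *)

(** * Convex combinations *)

(** The coefficient of [x j] is the complement to 1 of the other ones.  The
    weights are sums of two terms because [j] may itself belong to [S]. *)
Lemma convex_combination_relaxation (R : realType) (I : finType)
    (W : lmodType R) (S : {set I}) (j : I) (c : I -> R) (x : I -> W) :
  (forall k, k \in S -> 0 <= c k) -> \sum_(k in S) c k <= 1 ->
  convex_combination (j |: S) x (x j + \sum_(k in S) c k *: (x k - x j)).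
Proof.
move=> c_ge0 c_le1; set C := \sum_(k in S) c k.
pose w i := (if i == j then 1 - C else 0) + (if i \in S then c i else 0).
have sum_w (W' : lmodType R) (y : I -> W') :
    \sum_(i in j |: S) w i *: y i = (1 - C) *: y j + \sum_(k in S) c k *: y k.
  rewrite (eq_bigr (fun i => (if i == j then (1 - C) *: y i else 0) +
      (if i \in S then c i *: y i else 0))); last first.
    by move=> i _; rewrite /w scalerDl; do 2!case: ifP; rewrite ?scale0r.
  rewrite big_split /= -!big_mkcondr /=; congr (_ + _).
    rewrite (big_pred1 j) // => i /=.
    by rewrite !inE; case: (i == j); rewrite ?andbF.
  by apply: eq_bigl => i; rewrite !inE; case: (i \in S); rewrite ?orbT ?andbF.
exists w; split.
- move=> i _; apply: addr_ge0; first by case: ifP; rewrite ?subr_ge0.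
  by case: ifP => // /c_ge0.
- have /= := sum_w R^o (fun=> 1).
  rewrite (eq_bigr w) => [->|i _]; last exact: mulr1.
  rewrite [X in X + _]mulr1 (eq_bigr c) => [|i _]; last exact: mulr1.
  by rewrite subrK.
- rewrite sum_w scalerBl scale1r -addrA; congr (_ + _).
  under eq_bigr do rewrite scalerBr.
  by rewrite big_split /= sumrN -scaler_suml addrC.
Qed.

(** Some weight is nonzero because their sum is 1. *)
Lemma convex_combination_gt0 (R : realType) (I : finType) (W : lmodType R)
    (f : {linear W -> R^o}) (S : {set I}) (x : I -> W) (y : W) :
  convex_combination S x y -> (forall i, i \in S -> 0 < f (x i)) -> 0 < f y.
Proof.
case=> w [w_ge0 w_sum ->] fx_gt0; rewrite linear_sum /=.
under eq_bigr do rewrite linearZ /=.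
have wf_ge0 i : i \in S -> 0 <= w i * f (x i).
  by move=> iS; rewrite mulr_ge0 ?w_ge0 // ltW ?fx_gt0.
rewrite lt_neqAle sumr_ge0 // andbT eq_sym.
apply/negP => /eqP /(psumr_eq0P wf_ge0) wf0.
have : \sum_(i in S) w i = 0.
  apply: big1 => i iS; have /eqP := wf0 i iS.
  by rewrite mulf_eq0 (gt_eqF (fx_gt0 i iS)) orbF => /eqP.
by rewrite w_sum => /eqP; rewrite oner_eq0.
Qed.

(** * One time step *)

Section OneStep.
Variables (R : realType) (N G : nat) (M : mesh R N G) (g : R).
Variables (z : idx N G -> R) (dt : R) (a theta : 'I_N -> idx N G -> R).
Variables (s : sharp) (U : state R N G) (V : mstate R N G).
Hypothesis dt_gt0 : 0 < dt.

Lemma sigma_ge0 (j : 'I_N) (k : idx N G) : 0 <= sigma M j k.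
Proof. by rewrite divr_ge0 ?sqrtr_ge0 // fine_ge0 // measure_ge0. Qed.

Local Notation u := (uflux M g z a s U V).

(** Nonzero exactly on the faces through which the flow enters the cell. *)
Let inflow (j : 'I_N) (k : idx N G) : R :=
  if u j k < 0 then dt * (sigma M j k * `|u j k|) else 0.

Let inflow_ge0 j k : 0 <= inflow j k.
Proof.
rewrite /inflow; case: ifP => // _.
exact: mulr_ge0 (ltW dt_gt0) (mulr_ge0 (sigma_ge0 j k) (normr_ge0 _)).
Qed.

Let sum_inflow_le1 j :
  transport_cfl M g z dt a s U V -> \sum_(k in nb M j) inflow j k <= 1.
Proof.
apply: le_trans; rewrite -big_mkcondr -mulr_sumr ler_pM2l //.
exact: (le_bigmax _ (fun j => \sum_(k in nb M j | u j k < 0)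
  sigma M j k * `|u j k|)).
Qed.

Lemma Lcoef_ge0_of_transport_cfl (j : 'I_N) :
  transport_cfl M g z dt a s U V -> 0 <= Lcoef M g z dt a s U V j.
Proof.
move=> /(sum_inflow_le1 j); rewrite -subr_ge0 => /le_trans; apply.
rewrite /Lcoef lerD2l mulr_sumr -sumrN ler_sum // => k _.
rewrite /inflow; case: ltP => [u_lt0|u_ge0].
  by rewrite (ltr0_norm u_lt0) !mulrN opprK.
rewrite oppr0; exact: mulr_ge0 (ltW dt_gt0) (mulr_ge0 (sigma_ge0 j k) u_ge0).
Qed.

(** Strictness comes from [mtau V j != 0]: the factor L_j in
    tau_j^{n+1-} = tau_j^n L_j is nonnegative, and it is nonzero because the
    intermediate height is a genuine quotient. *)
Lemma acoustic_step_positive (j : 'I_N) :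
  acoustic_step M g z dt a theta s U V -> transport_cfl M g z dt a s U V ->
  0 < height U (inl j) ->
  0 < Lcoef M g z dt a s U V j /\ 0 < mheight V (inl j).
Proof.
move=> /(_ j)[tauE _ _ tau_neq0 ->] cfl h_gt0.
have tauL : mtau V j = tau U (inl j) * Lcoef M g z dt a s U V j.
  by rewrite tauE /Lcoef mulrDr mulr1 mulrA.
have L_gt0 : 0 < Lcoef M g z dt a s U V j.
  rewrite lt_def Lcoef_ge0_of_transport_cfl // andbT.
  by apply: contraNneq tau_neq0 => L0; rewrite tauL L0 mulr0.
by split; rewrite // tauL invr_gt0 mulr_gt0 // invr_gt0.
Qed.

(** Face by face, the upwind flux and the last term of the transport step add
    up to 0 when the flow leaves the cell, and to
    dt sigma_jk |u_jk| (phi_k - phi_j) when it enters. *)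
Lemma transport_step_convex_combination (U' : state R N G) (j : 'I_N) :
  transport_step M g z dt a s U V U' -> transport_cfl M g z dt a s U V ->
  convex_combination (inl j |: nb M j) (mconserved V) (conserved U' (inl j)).
Proof.
move=> /(_ j) /= -> /(sum_inflow_le1 j) sum_le1.
have := convex_combination_relaxation (inl j) (mconserved V)
  (fun k _ => inflow_ge0 j k) sum_le1.
congr (convex_combination _ _ _).
rewrite -addrA; congr (_ + _).
rewrite scaler_sumr mulr_sumr scaler_suml -sumrN -big_split /=.
apply: eq_bigr => k _; rewrite /inflow scalerA.
case: ltP => [u_lt0|u_ge0]; last by rewrite scale0r addNr.
by rewrite (ltr0_norm u_lt0) !mulrN scaleNr scalerBr opprB addrC.
Qed.

Lemma transport_step_height_gt0 (U' : state R N G) (j : 'I_N) :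
  transport_step M g z dt a s U V U' -> transport_cfl M g z dt a s U V ->
  positive_ghosts V -> (forall i, 0 < mheight V (inl i)) ->
  0 < height U' (inl j).
Proof.
move=> step cfl ghosts hV_gt0.
have cc := transport_step_convex_combination j step cfl.
apply: (convex_combination_gt0 (f := fst) cc).
by move=> [i|b] _ /=; [exact: hV_gt0 | exact: ghosts].
Qed.

End OneStep.

(** * All time steps *)

Lemma scheme_height_properties (R : realType) (N G : nat) (M : mesh R N G)
    (g : R) (z : idx N G -> R) (dt : nat -> R)
    (a theta : nat -> 'I_N -> idx N G -> R) (s : sharp)
    (U : nat -> state R N G) (V : nat -> mstate R N G) :
  (forall n, 0 < dt n) -> (forall n, positive_ghosts (V n)) ->
  (forall j, 0 < height (U 0%N) (inl j)) ->
  (forall n, scheme_step M g z (dt n) (a n) (theta n) s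
               (U n) (V n) (U n.+1)) ->
  (forall n, transport_cfl M g z (dt n) (a n) s (U n) (V n)) ->
  height_properties M g z dt a s U V.
Proof.
move=> dt_gt0 ghosts h0_gt0 step cfl.
have h_gt0 n : forall j, 0 < height (U n) (inl j).
  elim: n => // n IHn j; have [acoustic transport] := step n.
  apply: (transport_step_height_gt0 (dt_gt0 n) j transport (cfl n)) => // i.
  by have [] := acoustic_step_positive (dt_gt0 n) acoustic (cfl n) (IHn i).
split=> n j.
- by move=> _; apply: h_gt0.
- have [acoustic _] := step n.
  by have [] := acoustic_step_positive (dt_gt0 n) acoustic (cfl n) (h_gt0 n j).
- have [_ transport] := step n.
  exact: transport_step_convex_combination transport (cfl n).
Qed.

Theorem mainTheorem3 (R : realType) (N G : nat) (M : mesh R N G) (g : R)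
    (z : idx N G -> R) (dt : nat -> R) (a theta : nat -> 'I_N -> idx N G -> R)
    (U : nat -> state R N G) (V : nat -> mstate R N G)
    (g_gt0 : 0 < g)
    (dt_gt0 : forall n, 0 < dt n)
    (a_ge : forall n j k, k \in nb M j ->
      Num.max (height (U n) (inl j) * celerity g (U n) (inl j))
              (height (U n) k * celerity g (U n) k) <= a n j k)
    (ghost_gt0 : forall n, positive_ghosts (V n))
    (h0_gt0 : forall j, 0 < height (U 0%N) (inl j)) :
  ((forall n, scheme_step M g z (dt n) (a n) (theta n) Explicit
                (U n) (V n) (U n.+1)) ->
   (forall n, acoustic_cfl M (dt n) (a n) (U n)) ->
   (forall n, transport_cfl M g z (dt n) (a n) Explicit (U n) (V n)) ->
   height_properties M g z dt a Explicit U V)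
  /\
  ((forall n, scheme_step M g z (dt n) (a n) (theta n) Implicit
                (U n) (V n) (U n.+1)) ->
   (forall n, transport_cfl M g z (dt n) (a n) Implicit (U n) (V n)) ->
   height_properties M g z dt a Implicit U V).
Proof.
split=> [step _ cfl|step cfl].
  exact: scheme_height_properties step cfl.
exact: scheme_height_properties step cfl.
Qed.
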